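(* Let $M$ be a smooth connected manifold with a linear connection $\nabla$ (a connection on $TM$) with torsion $T$. For every $p$-form $\Theta\in\bigwedge^p(M)$, $$T_\Theta=d\Theta+\Xi_\Theta ,$$ where $T_\Theta$ and $\Xi_\Theta$ are the $(p+1)$-forms defined, for vector fields $X_1,\dots,X_{p+1}\in\mathfrak{X}(M)$, by $$\Xi_\Theta(X_1,\dots,X_{p+1})=\sum_{1\le i\le p+1}(-1)^{i}(\nabla_{X_i}\Theta)(X_1,\dots,\bar X_i,\dots,X_{p+1}),$$ $$T_\Theta(X_1,\dots,X_{p+1})=\sum_{1\le i<j\le p+1}(-1)^{i+j+1}\Theta(T(X_i,X_j),X_1,\dots,\bar X_i,\dots,\bar X_j,\dots,X_{p+1}).$$
   Context: $\mathfrak{X}(M)$ denotes smooth vector fields and $\bigwedge^p(M)$ smooth $p$-forms on $M$. A bar over an argument means it is omitted; empty sums are zero. The torsion is $T(X,Y)=\nabla_XY-\nabla_YX-[X,Y]$. The connection acts on forms as usual by $(\nabla_X\Theta)(Y_1,\dots,Y_p)=X(\Theta(Y_1,\dots,Y_p))-\sum_i\Theta(Y_1,\dots,\nabla_XY_i,\dots,Y_p)$. The exterior derivative is normalized by $$d\Theta(X_1,\dots,X_{p+1})=\sum_i(-1)^{i+1}X_i(\Theta(X_1,\dots,\bar X_i,\dots,X_{p+1}))+\sum_{i<j}(-1)^{i+j}\Theta([X_i,X_j],X_1,\dots,\bar X_i,\dots,\bar X_j,\dots,X_{p+1}).$$ *)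

(* Defs.v *)
From HB Require Import structures.
From mathcomp Require Import all_boot all_order all_algebra.
From mathcomp Require Import all_classical all_reals all_analysis.
From mathcomp Require Import ring lra.
Import Order.TTheory GRing.Theory Num.Theory numFieldNormedType.Exports.

Set Implicit Arguments.
Unset Strict Implicit.
Unset Printing Implicit Defensive.

Local Open Scope classical_set_scope.
Local Open Scope ring_scope.

Section EuclideanSmoothness.
Context {R : realType} {n : nat}.
Implicit Types (O : set 'rV[R]_n) (f g : 'rV[R]_n -> R).

(* All iterated partial derivatives up to order k exist and are continuous at
   every point of O. This is the usual notion of class C^k when O is open. *)
Fixpoint Ck (k : nat) O f : Prop :=
  (forall x, O x -> {for x, continuous f}) /\
  if k is k'.+1 then
    forall i : 'I_n, (forall x, O x -> derivable f x (delta_mx 0 i)) /\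
                     Ck k' O (fun x => 'D_(delta_mx 0 i) f x)
  else True.

Definition smooth_on O f : Prop := forall k, Ck k O f.

Lemma near_eq_open O f g x : open O -> (forall x, O x -> f x = g x) ->
  O x -> {near x, f =1 g}.
Proof.
move=> oO fg Ox; near=> y; apply: fg; near: y; exact: open_nbhs_nbhs.
Unshelve. all: by end_near. Qed.

Lemma eq_continuous_open O f g x : open O -> (forall x, O x -> f x = g x) ->
  O x -> {for x, continuous f} -> {for x, continuous g}.
Proof.
move=> oO fg Ox cf.
have : g @ x --> f x.
  apply: cvg_trans cf; apply: (@near_eq_cvg _ _ (nbhs x)).
  exact: near_eq_open oO fg Ox.
by rewrite (fg _ Ox).
Qed.

Lemma eq_Ck k O f g : open O -> (forall x, O x -> f x = g x) ->
  Ck k O f -> Ck k O g.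
Proof.
move=> oO; elim: k f g => [|k IH] f g fg [cf df].
  by split=> // x Ox; apply: (eq_continuous_open oO fg Ox); exact: cf.
split=> [x Ox|i]; first by apply: (eq_continuous_open oO fg Ox); exact: cf.
have [dfi cfi] := df i; split=> [x Ox|].
  exact: near_eq_derivable (near_eq_open oO fg Ox) (dfi _ Ox).
by apply: IH cfi => x Ox; apply: near_eq_derive; exact: near_eq_open oO fg Ox.
Qed.

Lemma CkW k O f : Ck k.+1 O f -> Ck k O f.
Proof.
elim: k f => [|k IH] f; first by case.
move=> [cf df]; split=> // i; have [dfi cfi] := df i.
by split=> //; exact: IH cfi.
Qed.

Lemma CkD k O f g : open O -> Ck k O f -> Ck k O g -> Ck k O (f + g).
Proof.
move=> oO; elim: k f g => [|k IH] f g [cf df] [cg dg].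
  by split=> // x Ox; exact: (@continuousD _ _ _ f g x (cf _ Ox) (cg _ Ox)).
split=> [x Ox|i]; first exact: (@continuousD _ _ _ f g x (cf _ Ox) (cg _ Ox)).
have [dfi cfi] := df i; have [dgi cgi] := dg i; split=> [x Ox|].
  exact: derivableD (dfi _ Ox) (dgi _ Ox).
apply: (@eq_Ck _ _ ((fun x => 'D_(delta_mx 0 i) f x)
  + (fun x => 'D_(delta_mx 0 i) g x))) => // [x Ox|]; last exact: IH.
by rewrite (deriveD (dfi _ Ox) (dgi _ Ox)).
Qed.

Lemma CkM k O f g : open O -> Ck k O f -> Ck k O g -> Ck k O (f * g).
Proof.
move=> oO; elim: k f g => [|k IH] f g Cf Cg.
  case: Cf Cg => [cf df] [cg dg]; split=> // x Ox.
  exact: (@continuousM _ _ f g x (cf _ Ox) (cg _ Ox)).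
case: (Cf) (Cg) => [cf df] [cg dg].
split=> [x Ox|i]; first exact: (@continuousM _ _ f g x (cf _ Ox) (cg _ Ox)).
have [dfi cfi] := df i; have [dgi cgi] := dg i; split=> [x Ox|].
  exact: derivableM (dfi _ Ox) (dgi _ Ox).
apply: (@eq_Ck _ _ (f * (fun x => 'D_(delta_mx 0 i) g x)
  + g * (fun x => 'D_(delta_mx 0 i) f x))) => // [x Ox|].
  by rewrite (deriveM (dfi _ Ox) (dgi _ Ox)).
by apply: CkD => //; apply: IH => //; exact: CkW.
Qed.

Lemma Ck_cst k O (a : R) : Ck k O (cst a).
Proof.
elim: k a => [|k IH] a; first by split=> // x _; exact: cst_continuous.
split=> [x _|i]; first exact: cst_continuous.
split=> [x _|]; first exact: derivable_cst.
have -> : (fun x => 'D_(delta_mx 0 i) (cst a) x) = cst 0 :> ('rV[R]_n -> R).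
  by apply/funext => x; rewrite derive_cst.
exact: IH.
Qed.

End EuclideanSmoothness.

(* [param] is the inverse homeomorphism of [coord]; its values outside
   [coord @` dom] are irrelevant. *)
Record chart (R : realType) (n : nat) (T : topologicalType) := Chart {
  dom : set T;
  coord : T -> 'rV[R]_n;
  param : 'rV[R]_n -> T;
  dom_open : open dom;
  codom_open : open (coord @` dom);
  coordK : forall x, dom x -> param (coord x) = x;
  coord_continuous : forall x, dom x -> {for x, continuous coord};
  param_continuous : forall y, (coord @` dom) y -> {for y, continuous param} }.

Record manifold (R : realType) (n : nat) := Manifold {
  mspace :> topologicalType;
  atlas : set (chart R n mspace);
  manifold_hausdorff : hausdorff_space mspace;
  manifold_second_countable : @second_countable mspace;
  atlas_cover : forall x : mspace, exists2 c, atlas c & dom c x;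
  atlas_compatible : forall c d, atlas c -> atlas d -> forall j : 'I_n,
    smooth_on (coord c @` (dom c `&` dom d))
      (fun y => coord d (param c y) 0 j) }.

Section SmoothFunctions.
Context {R : realType} {n : nat} (M : manifold R n).

Definition smooth (f : M -> R) : Prop :=
  forall c, atlas c -> smooth_on (coord c @` dom c) (f \o param c).

Definition smooth_pred : {pred M -> R} := fun f => `[< smooth f >].

Record Cinf := MkCinf { cfun :> M -> R; cfunP : cfun \in smooth_pred }.

HB.instance Definition _ := [isSub for cfun].
HB.instance Definition _ := [Choice of Cinf by <:].

Lemma smooth_cst (a : R) : smooth (cst a).
Proof. by move=> c _ k; exact: Ck_cst. Qed.

Lemma smoothD (f g : M -> R) : smooth f -> smooth g -> smooth (f + g).
Proof.
move=> sf sg c ac k.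
exact: (CkD (@codom_open _ _ _ c) (sf _ ac k) (sg _ ac k)).
Qed.

Lemma smoothM (f g : M -> R) : smooth f -> smooth g -> smooth (f * g).
Proof.
move=> sf sg c ac k.
exact: (CkM (@codom_open _ _ _ c) (sf _ ac k) (sg _ ac k)).
Qed.

Lemma smoothB (f g : M -> R) : smooth f -> smooth g -> smooth (f - g).
Proof.
move=> sf sg; have -> : f - g = f + cst (-1) * g.
  by apply/funext => x; rewrite !fctE mulN1r.
by apply: smoothD => //; apply: smoothM => //; exact: smooth_cst.
Qed.

Lemma smooth_subring_closed : subring_closed smooth_pred.
Proof.
split=> [|f g /asboolP sf /asboolP sg|f g /asboolP sf /asboolP sg]; apply/asboolP.
- exact: smooth_cst.
- exact: smoothB.
- exact: smoothM.
Qed.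

HB.instance Definition _ :=
  GRing.SubChoice_isSubComPzRing.Build (M -> R) smooth_pred Cinf
    smooth_subring_closed.

Definition mk_smooth (f : M -> R) (sf : smooth f) : Cinf :=
  @MkCinf f (asboolT sf).

Definition const (a : R) : Cinf := mk_smooth (smooth_cst a).

Lemma cfun_smooth (f : Cinf) : smooth f.
Proof. by apply/asboolP; exact: cfunP. Qed.

Lemma cfun_inj (f g : Cinf) : (forall x, f x = g x) -> f = g.
Proof. by move=> fg; apply: val_inj; apply/funext. Qed.

Lemma cfunD (f g : Cinf) x : (f + g) x = f x + g x. Proof. by []. Qed.
Lemma cfunM (f g : Cinf) x : (f * g) x = f x * g x. Proof. by []. Qed.
Lemma cfunN (f : Cinf) x : (- f) x = - f x. Proof. by []. Qed.
Lemma constE (a : R) x : const a x = a. Proof. by []. Qed.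

(* T_x M is the space of R-linear derivations at x of the algebra of smooth
   functions. *)
Definition tangent_at (x : M) (v : Cinf -> R) : Prop :=
  (forall (a : R) (f g : Cinf), v (const a * f + g) = a * v f + v g) /\
  (forall f g : Cinf, v (f * g) = v f * g x + f x * v g).

(* A field of tangent vectors is smooth iff it maps smooth functions to smooth
   functions. *)
Record vfield := VField {
  vfun :> M -> Cinf -> R;
  vfun_tangent : forall x, tangent_at x (vfun x);
  vfun_smooth : forall f : Cinf, smooth (fun x => vfun x f) }.

Definition act (X : vfield) (f : Cinf) : Cinf := mk_smooth (vfun_smooth X f).

End SmoothFunctions.

Section VectorFields.
Context {R : realType} {n : nat} {M : manifold R n}.
Implicit Types (X Y Z : vfield M) (f g : Cinf M).

Lemma vfield_inj X Y : (forall x f, X x f = Y x f) -> X = Y.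
Proof.
case: X Y => [X tX sX] [Y tY sY] /= XY.
have EXY : X = Y by apply/funext => x; apply/funext => f.
by rewrite EXY in tX sX *; congr VField; exact: Prop_irrelevance.
Qed.

HB.instance Definition _ := gen_eqMixin (vfield M).
HB.instance Definition _ := gen_choiceMixin (vfield M).

Lemma vf_lin X x (a : R) f g : X x (const M a * f + g) = a * X x f + X x g.
Proof. by case: (vfun_tangent X x). Qed.

Lemma vf_leibniz X x f g : X x (f * g) = X x f * g x + f x * X x g.
Proof. by case: (vfun_tangent X x). Qed.

Lemma vfD X x f g : X x (f + g) = X x f + X x g.
Proof.
rewrite -[X x f]mul1r -vf_lin; congr (X x (_ + _)).
by apply: cfun_inj => y; rewrite cfunM constE mul1r.
Qed.

Lemma vfZ X x (a : R) f : X x (const M a * f) = a * X x f.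
Proof.
have X0 : X x 0 = 0 by apply: (addrI (X x 0)); rewrite -vfD !addr0.
by rewrite -[_ * f]addr0 vf_lin X0 addr0.
Qed.

Lemma act_lin X (a : R) f g : act X (const M a * f + g) = const M a * act X f + act X g.
Proof. by apply: cfun_inj => x; rewrite /= vf_lin. Qed.

Lemma act_leibniz X f g : act X (f * g) = act X f * g + f * act X g.
Proof. by apply: cfun_inj => x; rewrite /= vf_leibniz. Qed.

(* Pointwise linear combinations, and the Lie bracket
   [X, Y]_x f = X_x (Y f) - Y_x (X f). *)

Fact vzero_tangent (x : M) : tangent_at x (fun=> 0).
Proof. by split=> *; rewrite ?(mulr0, mul0r, addr0). Qed.
Fact vzero_smooth f : smooth (fun x : M => 0 : R).
Proof. exact: smooth_cst. Qed.
Definition vzero : vfield M := VField vzero_tangent vzero_smooth.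

Fact vopp_tangent X (x : M) : tangent_at x (fun f => - X x f).
Proof.
split=> *; first by rewrite vf_lin opprD mulrN.
by rewrite vf_leibniz opprD mulNr mulrN.
Qed.
Fact vopp_smooth X f : smooth (fun x : M => - X x f).
Proof. exact: (cfun_smooth (- act X f)). Qed.
Definition vopp X : vfield M := VField (vopp_tangent X) (vopp_smooth X).

Fact vadd_tangent X Y (x : M) : tangent_at x (fun f => X x f + Y x f).
Proof.
split=> *; first by rewrite !vf_lin mulrDr addrACA.
by rewrite !vf_leibniz mulrDr mulrDl addrACA.
Qed.
Fact vadd_smooth X Y f : smooth (fun x : M => X x f + Y x f).
Proof. exact: (cfun_smooth (act X f + act Y f)). Qed.
Definition vadd X Y : vfield M := VField (vadd_tangent X Y) (vadd_smooth X Y).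

Fact vscale_tangent (h : Cinf M) X (x : M) : tangent_at x (fun f => h x * X x f).
Proof.
split=> [a f g|f g]; first by rewrite vf_lin mulrDr mulrCA.
by rewrite vf_leibniz mulrDr mulrA mulrCA.
Qed.
Fact vscale_smooth (h : Cinf M) X f : smooth (fun x : M => h x * X x f).
Proof. exact: (cfun_smooth (h * act X f)). Qed.
Definition vscale (h : Cinf M) X : vfield M :=
  VField (vscale_tangent h X) (vscale_smooth h X).

Fact lie_tangent X Y (x : M) :
  tangent_at x (fun f => X x (act Y f) - Y x (act X f)).
Proof.
split=> [a f g|f g].
  by rewrite !act_lin !vf_lin opprD addrACA -mulrN -mulrDr.
rewrite !act_leibniz !vfD !vf_leibniz mulrBl mulrBr /= !opprD !addrA.
by rewrite /act /=; lra.
Qed.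
Fact lie_smooth X Y f : smooth (fun x : M => X x (act Y f) - Y x (act X f)).
Proof. exact: (cfun_smooth (act X (act Y f) - act Y (act X f))). Qed.
Definition lie X Y : vfield M := VField (lie_tangent X Y) (lie_smooth X Y).

Fact vaddA : associative vadd.
Proof. by move=> X Y Z; apply: vfield_inj => x f /=; rewrite addrA. Qed.
Fact vaddC : commutative vadd.
Proof. by move=> X Y; apply: vfield_inj => x f /=; rewrite addrC. Qed.
Fact vadd0 : left_id vzero vadd.
Proof. by move=> X; apply: vfield_inj => x f /=; rewrite add0r. Qed.
Fact vaddN : left_inverse vzero vopp vadd.
Proof. by move=> X; apply: vfield_inj => x f /=; rewrite addNr. Qed.

HB.instance Definition _ :=
  GRing.isZmodule.Build (vfield M) vaddA vaddC vadd0 vaddN.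

Fact vscaleA f g X : vscale f (vscale g X) = vscale (f * g) X.
Proof. by apply: vfield_inj => x h /=; rewrite mulrA. Qed.
Fact vscale1 : left_id 1 vscale.
Proof. by move=> X; apply: vfield_inj => x h /=; rewrite mul1r. Qed.
Fact vscaleDr : right_distributive vscale +%R.
Proof. by move=> f X Y; apply: vfield_inj => x h /=; rewrite mulrDr. Qed.
Fact vscaleDl X : {morph vscale^~ X : f g / f + g}.
Proof. by move=> f g; apply: vfield_inj => x h /=; rewrite mulrDl. Qed.

HB.instance Definition _ := GRing.Zmodule_isLmodule.Build (Cinf M) (vfield M)
  vscaleA vscale1 vscaleDr vscaleDl.

End VectorFields.

(* R-linearity of [nabla] in its second argument follows from the last two
   fields, since X(c) = 0 for a constant c. *)
Record connection (R : realType) (n : nat) (M : manifold R n) := Connection {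
  nabla :> vfield M -> vfield M -> vfield M;
  nabla_linl : forall (f : Cinf M) (X Y Z : vfield M),
    nabla (f *: X + Y) Z = f *: nabla X Z + nabla Y Z;
  nablaD : forall X Y Z : vfield M, nabla X (Y + Z) = nabla X Y + nabla X Z;
  nabla_leibniz : forall (f : Cinf M) (X Y : vfield M),
    nabla X (f *: Y) = act X f *: Y + f *: nabla X Y }.

Section Forms.
Context {R : realType} {n : nat} {M : manifold R n}.

Definition torsion (D : connection M) (X Y : vfield M) : vfield M :=
  D X Y - D Y X - lie X Y.

Definition replace p (X : 'I_p -> vfield M) (i : 'I_p) (Y : vfield M) :
    'I_p -> vfield M :=
  fun k => if k == i then Y else X k.

Definition omit p (X : 'I_p.+1 -> vfield M) (i : 'I_p.+1) : 'I_p -> vfield M :=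
  fun k => X (lift i k).

(* The p arguments Z, X_1, ..., X_{p+1} with X_i and X_j omitted; for i <> j
   the list has exactly p elements, so the default value of nth is not used. *)
Definition omit2 p (Z : vfield M) (X : 'I_p.+1 -> vfield M) (i j : 'I_p.+1) :
    'I_p -> vfield M :=
  fun k => nth 0 (Z :: [seq X l | l <- enum 'I_p.+1 & (l != i) && (l != j)]) k.

(* Smooth p-forms as alternating Cinf M-multilinear maps on vector fields. *)
Definition is_form p (w : ('I_p -> vfield M) -> Cinf M) : Prop :=
  (forall (X : 'I_p -> vfield M) i (f : Cinf M) (Y Z : vfield M),
     w (replace X i (f *: Y + Z)) = f * w (replace X i Y) + w (replace X i Z)) /\
  (forall (X : 'I_p -> vfield M) i j, i != j -> X i = X j -> w X = 0).

Definition cov_deriv p (D : connection M) (X : vfield M)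
    (w : ('I_p -> vfield M) -> Cinf M) : ('I_p -> vfield M) -> Cinf M :=
  fun Y => act X (w Y) - \sum_(i < p) w (replace Y i (D X (Y i))).

(* Ordinals start at 0, so X i is the vector field X_{i+1} of the usual
   formulas, and each i or j of a usual exponent is written i.+1 or j.+1. *)
Definition ext_d p (w : ('I_p -> vfield M) -> Cinf M) :
    ('I_p.+1 -> vfield M) -> Cinf M :=
  fun X =>
    \sum_(i < p.+1) (-1) ^+ (i.+1 + 1) * act (X i) (w (omit X i)) +
    \sum_(i < p.+1) \sum_(j < p.+1 | (i < j)%N)
      (-1) ^+ (i.+1 + j.+1) * w (omit2 (lie (X i) (X j)) X i j).

Definition Xi_form p (D : connection M) (w : ('I_p -> vfield M) -> Cinf M) :
    ('I_p.+1 -> vfield M) -> Cinf M :=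
  fun X => \sum_(i < p.+1) (-1) ^+ i.+1 * cov_deriv D (X i) w (omit X i).

Definition torsion_form p (D : connection M) (w : ('I_p -> vfield M) -> Cinf M) :
    ('I_p.+1 -> vfield M) -> Cinf M :=
  fun X => \sum_(i < p.+1) \sum_(j < p.+1 | (i < j)%N)
    (-1) ^+ (i.+1 + j.+1 + 1) * w (omit2 (torsion D (X i) (X j)) X i j).

End Forms.

(* Main.v *)
(* Antisymmetrising the arguments of a family of p-forms F_X, linear in X, gives
   a (p+1)-form; applied to F_X = nabla_X Theta this is Xi_Theta.
   For the torsion take F_X = - sum_k Theta(..., T(X, X_k), ...), the action on
   Theta of the derivation defined by the tensor T(X, .): moving each argument T(X_i, X_j) to the front shows that its
   antisymmetrisation counts every pair {i, j} twice with the same sign, so it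
   is 2 T_Theta. The same move to the front, with nabla in place of T, turns
   the second part of Xi_Theta into a sum over i < j of
   Theta(nabla_{X_i} X_j - nabla_{X_j} X_i, ...); its first part cancels the
   derivative terms of d Theta, and what remains is T_Theta. *)
Require Import Defs.
From mathcomp Require Import all_boot all_order all_algebra.
From mathcomp Require Import all_classical all_reals all_analysis.
From mathcomp Require Import fingroup perm zify ring lra.
Import GRing.Theory.

Set Implicit Arguments.
Unset Strict Implicit.
Unset Printing Implicit Defensive.

Local Open Scope ring_scope.

(** * Tuples of vector fields with entries replaced or omitted *)

Section Arguments.
Context {R : realType} {n : nat} {M : manifold R n}.

Lemma replace_same p (X : 'I_p -> vfield M) i Y : replace X i Y i = Y.
Proof. by rewrite /replace eqxx. Qed.

Lemma replace_neq p (X : 'I_p -> vfield M) i k Y :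
  k != i -> replace X i Y k = X k.
Proof. by rewrite /replace => /negPf ->. Qed.

Lemma replace_id p (X : 'I_p -> vfield M) i : replace X i (X i) = X.
Proof. by apply/funext => k; rewrite /replace; case: eqP => [->|]. Qed.

Lemma replaceK p (X : 'I_p -> vfield M) i Y Z :
  replace (replace X i Y) i Z = replace X i Z.
Proof. by apply/funext => k; rewrite /replace; case: eqP. Qed.

Lemma replaceC p (X : 'I_p -> vfield M) i j Y Z : i != j ->
  replace (replace X i Y) j Z = replace (replace X j Z) i Y.
Proof.
move=> ij; apply/funext => k; rewrite /replace.
by case: (eqVneq k j) => [->|//]; rewrite eq_sym (negPf ij).
Qed.

Lemma omit_replace p (X : 'I_p.+1 -> vfield M) i Y :
  omit (replace X i Y) i = omit X i.
Proof. by apply/funext => k; rewrite /omit replace_neq // eq_sym neq_lift. Qed.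

Lemma omit_replace_lift p (X : 'I_p.+1 -> vfield M) i k Y :
  omit (replace X (lift i k) Y) i = replace (omit X i) k Y.
Proof.
by apply/funext => l; rewrite /omit /replace (inj_eq (@lift_inj _ i)).
Qed.

Lemma omit2C p (Z : vfield M) (X : 'I_p.+1 -> vfield M) i j :
  omit2 Z X i j = omit2 Z X j i.
Proof. by rewrite /omit2; under eq_filter do rewrite andbC. Qed.

(** Both lists increase strictly and have the same members, which determines them. *)
Lemma filter_enum_lift p (i : 'I_p.+1) :
  [seq l <- enum 'I_p.+1 | l != i] = [seq lift i l | l <- enum 'I_p].
Proof.
pose r := relpre (@nat_of_ord p.+1) ltn.
have rtr : transitive r by move=> x y z; exact: ltn_trans.
have sorted_enum m : sorted (relpre (@nat_of_ord m) ltn) (enum 'I_m).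
  by rewrite -sorted_map val_enum_ord iota_ltn_sorted.
apply: (irr_sorted_eq rtr) => [x||| x].
- exact: ltnn.
- by apply: sorted_filter => //; exact: sorted_enum.
- rewrite sorted_map; apply: sub_sorted (sorted_enum p) => x y /=.
  by rewrite /bump; lia.
rewrite mem_filter mem_enum andbT; apply/idP/mapP => [xi|[k _ ->]].
  have [k -> _] : {k | x = lift i k & unlift i x = Some k}.
    by apply: unlift_some; rewrite eq_sym.
  by exists k; rewrite ?mem_enum.
by rewrite eq_sym neq_lift.
Qed.

(** The index [lift ord0 l] passes over the front argument [Z]; behind it, entry [lift i k] of [X]
    is entry [k] once [i] is gone. *)
Lemma omit2_lift p Z (X : 'I_p.+2 -> vfield M) i k (l : 'I_p) :
  omit2 Z X i (lift i k) (lift ord0 l) = omit (omit X i) k l.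
Proof.
rewrite /omit2 lift0; set s := map _ _; rewrite [LHS]/= {}/s.
under eq_filter do rewrite andbC.
rewrite (filter_predI (fun l => l != lift i k)) filter_enum_lift filter_map.
rewrite (@eq_filter _ _ (fun a => a != k)); last first.
  by move=> a; rewrite /= (inj_eq (@lift_inj _ i)).
rewrite filter_enum_lift -2!map_comp (nth_map l) ?size_enum_ord //.
by rewrite nth_ord_enum.
Qed.

End Arguments.

(** * Signs of alternating forms under permutations *)

Section Alternating.
Context {R : realType} {n : nat} {M : manifold R n} {p : nat}.
Context {w : ('I_p -> vfield M) -> Cinf M} (w_form : is_form w).
Implicit Types (X : 'I_p -> vfield M).

Lemma form_lin X i f Y Z :
  w (replace X i (f *: Y + Z)) = f * w (replace X i Y) + w (replace X i Z).
Proof. by case: w_form. Qed.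

Lemma form_alt X i j : i != j -> X i = X j -> w X = 0.
Proof. by case: w_form => _; apply. Qed.

Lemma form_add X i Y Z :
  w (replace X i (Y + Z)) = w (replace X i Y) + w (replace X i Z).
Proof. by rewrite -[Y]scale1r form_lin mul1r scale1r. Qed.

(** Polarisation: put [X i + X j] in both slots and expand; the two terms with equal arguments
    vanish. *)
Lemma form_tperm X i j : i != j -> w (X \o tperm i j) = - w X.
Proof.
move=> ij; pose Y a b := replace (replace X i a) j b.
have alt a : w (Y a a) = 0.
  by apply: (form_alt ij); rewrite /Y replace_same replace_neq ?replace_same.
have YDl a b c : w (Y (a + b) c) = w (Y a c) + w (Y b c).
  by rewrite /Y ![replace (replace X i _) _ _]replaceC // form_add.
have := alt (X i + X j); rewrite YDl /Y !form_add -!/(Y _ _) !alt add0r addr0.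
move=> /eqP; rewrite addr_eq0 => /eqP YE.
have YX : w (Y (X i) (X j)) = w X by rewrite /Y !replace_id.
rewrite -YX YE opprK; congr w; apply/funext => k; rewrite /Y /replace /=.
by case: tpermP => [->|->|/eqP/negPf-> /eqP/negPf->//]; rewrite eqxx // (negPf ij).
Qed.

Lemma form_perm X (s : {perm 'I_p}) : w (X \o s) = (-1) ^+ s * w X.
Proof.
have [ts -> tsd] := prod_tpermP s.
elim: ts tsd X => [_|[i j] ts IH /= /andP[ij tsd]] X.
  rewrite big_nil odd_perm1 expr0 mul1r; congr w.
  by apply/funext => k; rewrite /= perm1.
rewrite big_cons odd_mul_tperm ij signr_addb /= expr1 mulN1r mulNr -IH //.
rewrite -(form_tperm _ ij); congr w; apply/funext => k /=.
by rewrite permM.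
Qed.

End Alternating.

(** * Sums and signs over pairs of distinct indices *)

Lemma sum_lift (V : zmodType) p (g : 'I_p.+1 -> V) (i : 'I_p.+1) :
  \sum_(k < p) g (lift i k) = \sum_(j | j != i) g j.
Proof.
apply: (addrI (g i)); transitivity (\sum_j g j); last exact: bigD1.
by symmetry; apply: (@bigD1_ord _ _ _ _ i xpredT).
Qed.

Lemma sum_lift_pairs (V : zmodType) p (g : 'I_p.+1 -> 'I_p.+1 -> V) :
  \sum_(i < p.+1) \sum_(k < p) g i (lift i k) =
  \sum_(i < p.+1) \sum_(j < p.+1 | (i < j)%N) (g i j + g j i).
Proof.
under [RHS]eq_bigr do rewrite big_split /=.
rewrite big_split /= [X in _ + X](exchange_big_dep xpredT) //= -big_split /=.
apply: eq_bigr => i _; rewrite sum_lift (bigID (fun j : 'I__ => (i < j)%N)) /=.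
by congr (_ + _); apply: eq_bigl => j; rewrite -val_eqE /=; lia.
Qed.

(** Removing one index lowers the other only if the other is larger, so the two exponents differ by
    one. *)
Lemma signr_lift (S : pzRingType) p (i j : 'I_p.+1) (k l : 'I_p) :
  lift i k = j -> lift j l = i ->
  (-1) ^+ (i.+1 + k) = - (-1) ^+ (j.+1 + l) :> S.
Proof.
move=> /(congr1 val) /= ik /(congr1 val) /= jl.
rewrite -[RHS]mulN1r -exprS -signr_odd -[RHS]signr_odd.
by congr (_ ^+ _); move: ik jl; rewrite /bump; lia.
Qed.

(** * Moving an argument to the front *)

Section FrontArgument.
Context {R : realType} {n : nat} {M : manifold R n} {p : nat}.
Context {w : ('I_p -> vfield M) -> Cinf M} (w_form : is_form w).
Implicit Types (X : 'I_p.+1 -> vfield M).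

(* Replacing in place and moving to the front differ by a cycle of length k+1. *)
Lemma form_omit2 Z X i (k : 'I_p) :
  w (omit2 Z X i (lift i k)) = (-1) ^+ k * w (replace (omit X i) k Z).
Proof.
case: p w w_form X i k => [|q] w' w'_form X i k; first by case: k.
have kE : odd k = lift_perm ord0 k 1 by rewrite odd_lift_perm odd_perm1 addbF.
rewrite -signr_odd kE -form_perm //; congr w'; apply: funext => l /=.
case: (unliftP ord0 l) => [l' ->|->].
  by rewrite omit2_lift lift_perm_lift perm1 replace_neq // eq_sym neq_lift.
by rewrite lift_perm_id replace_same.
Qed.

Lemma form_replace_omit Z X i (k : 'I_p) :
  w (replace (omit X i) k Z) = (-1) ^+ k * w (omit2 Z X i (lift i k)).
Proof. by rewrite form_omit2 signrMK. Qed.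

(** Put back in slot [k], the front argument is subject to linearity; the sign is common to all
    terms. *)
Lemma form_omit2B Y Z X i j : i != j ->
  w (omit2 (Y - Z) X i j) = w (omit2 Y X i j) - w (omit2 Z X i j).
Proof.
case/unlift_some => k -> _; rewrite !form_omit2 -mulrBr; congr (_ * _).
by apply/eqP; rewrite eq_sym subr_eq -form_add // subrK.
Qed.

(** Serves for [B] the connection and for [B] the torsion. After the move to the front, the terms of
    [i, j] and [j, i] omit the same entries and have opposite signs. *)
Lemma form_lift_pairs (B : vfield M -> vfield M -> vfield M) X :
  \sum_(i < p.+1) (-1) ^+ i.+1 *
    \sum_(k < p) w (replace (omit X i) k (B (X i) (X (lift i k)))) =
  \sum_(i < p.+1) \sum_(j < p.+1 | (i < j)%N)
    (-1) ^+ (i.+1 + j.+1) * w (omit2 (B (X i) (X j) - B (X j) (X i)) X i j).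
Proof.
(* [unbump i j] is the position of [j] once [i] is omitted, that is, the [k] with [lift i k = j]. *)
pose g (i j : 'I_p.+1) :=
  (-1) ^+ (i.+1 + unbump i j) * w (omit2 (B (X i) (X j)) X i j).
transitivity (\sum_(i < p.+1) \sum_(k < p) g i (lift i k)).
  apply: eq_bigr => i _; rewrite mulr_sumr; apply: eq_bigr => k _.
  by rewrite form_replace_omit mulrA -exprD /g /= bumpK.
rewrite sum_lift_pairs; apply: eq_bigr => i _; apply: eq_bigr => j ij.
have ij' : i != j by rewrite -val_eqE neq_ltn ij.
have gij : (-1) ^+ (i.+1 + unbump i j) = (-1) ^+ (i.+1 + j.+1) :> Cinf M.
  rewrite -signr_odd -[RHS]signr_odd; congr (_ ^+ _).
  by rewrite /unbump; move: ij; lia.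
have gji : (-1) ^+ (j.+1 + unbump j i) = - (-1) ^+ (i.+1 + j.+1) :> Cinf M.
  rewrite -[RHS]mulN1r -exprS -signr_odd -[RHS]signr_odd; congr (_ ^+ _).
  by rewrite /unbump; move: ij; lia.
by rewrite form_omit2B // /g gij gji (omit2C _ _ j i) mulNr -mulrBr.
Qed.

End FrontArgument.

(** * Antisymmetrisation of a linear family of forms *)

Section AlternatingSum.
Context {R : realType} {n : nat} {M : manifold R n} {p : nat}.
Context {F : vfield M -> ('I_p -> vfield M) -> Cinf M}.
Hypothesis F_form : forall X, is_form (F X).
Hypothesis F_lin : forall f X Y Z, F (f *: X + Y) Z = f * F X Z + F Y Z.

(** Slot [m] is the subscript of [F] in the term [i = m], where [F_lin] applies, and an argument of
    a form in the others. If [X a = X b], every term but [a] and [b] keeps two equal arguments. *)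
Lemma alternating_sum_form :
  is_form (fun X : 'I_p.+1 -> vfield M =>
    \sum_(i < p.+1) (-1) ^+ i.+1 * F (X i) (omit X i)).
Proof.
split=> [X m f Y Z|X a b ab Xab].
  rewrite mulr_sumr -big_split; apply: eq_bigr => i _ /=.
  rewrite mulrCA -mulrDr; congr (_ * _).
  have [->|im] := eqVneq i m; first by rewrite !replace_same !omit_replace F_lin.
  have [k -> _] := unlift_some im.
  by rewrite !replace_neq ?neq_lift // !omit_replace_lift form_lin.
rewrite (bigD1 a) // (bigD1 b) /= 1?eq_sym // addrA.
rewrite [X in _ + X]big1 => [|i /andP[ia ib]].
  have [k bE _] := unlift_some ab; have ba : b != a by rewrite eq_sym.
  have [l aE _] := unlift_some ba.
  (* Moving the remaining copy of the repeated field to the front makes the terms [a] and [b] equal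
     up to sign; they cancel by [signr_lift]. *)
  have omitE (i j : 'I_p.+1) (h : 'I_p) : j = lift i h -> X i = X j ->
      (-1) ^+ i.+1 * F (X i) (omit X i) =
      (-1) ^+ (i.+1 + h) * F (X i) (omit2 (X i) X i j).
    move=> -> Xij; rewrite exprD -mulrA -form_replace_omit // Xij.
    by congr (_ * F _ _); rewrite (replace_id (omit X i)).
  rewrite addr0 (omitE _ _ _ bE) // (omitE _ _ _ aE) // -Xab omit2C.
  by rewrite (signr_lift _ (esym bE) (esym aE)) mulNr addNr.
have [k aE _] := unlift_some ia; have [l bE _] := unlift_some ib.
rewrite (@form_alt _ _ _ _ _ (F_form _) _ k l) ?mulr0 //.
  by apply: contra ab => /eqP kl; rewrite aE bE kl.
by rewrite /omit -aE -bE.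
Qed.

End AlternatingSum.

(* A first-order operator [A] on vector fields with symbol [a] acts on forms:
   both nabla_X (with [a] = X) and T(X, .) (with [a] = 0) are of this kind. *)
Section Derivation.
Context {R : realType} {n : nat} {M : manifold R n}.
Context {a : Cinf M -> Cinf M} {A : vfield M -> vfield M}.
Hypothesis aD : forall f g, a (f + g) = a f + a g.
Hypothesis aM : forall f g, a (f * g) = a f * g + f * a g.
Hypothesis AD : forall X Y, A (X + Y) = A X + A Y.
Hypothesis AZ : forall f X, A (f *: X) = a f *: X + f *: A X.

(** The [a f] from differentiating the coefficient cancels the one from [A (f *: Y)]. For equal
    arguments, the terms of their two slots differ by a transposition. *)
Lemma derivation_form p (w : ('I_p -> vfield M) -> Cinf M) : is_form w ->
  is_form (fun X => a (w X) - \sum_(i < p) w (replace X i (A (X i)))).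
Proof.
move=> w_form; split=> [X m f Y Z|X i j ij Xij].
  have sumE V : \sum_(i < p) w (replace (replace X m V) i (A (replace X m V i))) =
      w (replace X m (A V)) +
      \sum_(i < p | i != m) w (replace (replace X i (A (X i))) m V).
    rewrite (bigD1 m) //= replace_same replaceK; congr (_ + _).
    by apply: eq_bigr => i im; rewrite replace_neq // replaceC // eq_sym.
  rewrite !sumE AD AZ -addrA !form_lin // aD aM.
  under eq_bigr do rewrite form_lin //.
  rewrite big_split /= -mulr_sumr; ring.
have a0 : a 0 = 0 by apply: (addrI (a 0)); rewrite -aD !addr0.
rewrite (form_alt w_form ij Xij) a0 sub0r (bigD1 i) // (bigD1 j) 1?eq_sym //=.
rewrite [X in _ + (_ + X)]big1 => [|k /andP[ki kj]].
  have -> : replace X j (A (X j)) = replace X i (A (X i)) \o tperm i j.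
    apply/funext => k; rewrite /replace /= -Xij.
    case: tpermP => [->|->|/eqP/negPf-> /eqP/negPf->//]; last by rewrite !eqxx.
    by rewrite (negPf ij) [j == i]eq_sym (negPf ij) Xij.
  by rewrite form_tperm // addr0 subrr oppr0.
by apply: (form_alt w_form ij); rewrite !replace_neq // eq_sym.
Qed.

End Derivation.

(** * The torsion as a skew tensor *)

Section Torsion.
Context {R : realType} {n : nat} {M : manifold R n}.
Implicit Types (D : connection M) (X Y Z : vfield M) (f : Cinf M).

Lemma actD X f g : act X (f + g) = act X f + act X g.
Proof. by apply: cfun_inj => x; rewrite /= vfD. Qed.

Lemma torsionC D X Y : torsion D Y X = - torsion D X Y.
Proof.
by apply: vfield_inj => x f /=; ring.
Qed.

Lemma torsionDr D X Y Z : torsion D X (Y + Z) = torsion D X Y + torsion D X Z.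
Proof.
have lieD : lie X (Y + Z) = lie X Y + lie X Z.
  apply: vfield_inj => x f /=.
  rewrite (_ : act (Y + Z) f = act Y f + act Z f); last exact: cfun_inj.
  by rewrite vfD; ring.
have nabla_addl : D (Y + Z) X = D Y X + D Z X.
  by rewrite -[Y]scale1r nabla_linl !scale1r.
by rewrite /torsion nablaD nabla_addl lieD; apply: vfield_inj => x f /=; ring.
Qed.

(** The term [act X f *: Y] of the covariant derivative cancels that of the bracket. *)
Lemma torsionZr D X f Y : torsion D X (f *: Y) = f *: torsion D X Y.
Proof.
have lieZ : lie X (f *: Y) = act X f *: Y + f *: lie X Y.
  apply: vfield_inj => x g /=.
  rewrite (_ : act (f *: Y) g = f * act Y g); last exact: cfun_inj.
  by rewrite vf_leibniz /=; ring.
have nablaZ : D (f *: Y) X = f *: D Y X.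
  have D0 : D 0 X = 0.
    have := nabla_linl D 1 0 0 X; rewrite !scale1r addr0 => /esym/eqP.
    by rewrite -subr_eq0 addrK => /eqP.
  by rewrite -[f *: Y]addr0 nabla_linl D0 addr0.
by rewrite /torsion nabla_leibniz nablaZ lieZ; apply: vfield_inj => x g /=; ring.
Qed.

(* Cancelling the factor 2 is possible because functions are real valued. *)
Lemma form_of_double p (v : ('I_p -> vfield M) -> Cinf M) :
  is_form (fun V => v V + v V) -> is_form v.
Proof.
have double_inj f g : f + f = g + g -> f = g.
  move=> fg; apply: cfun_inj => x.
  have : f x + f x = g x + g x by rewrite -!cfunD fg.
  lra.
move=> [v_lin v_alt]; split=> [V i f Y Z|V i j ij Vij]; apply: double_inj.
  by rewrite v_lin; ring.
by rewrite (v_alt V i j) // addr0.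
Qed.

Lemma torsion_linl D X Y Z f :
  torsion D (f *: X + Y) Z = f *: torsion D X Z + torsion D Y Z.
Proof.
rewrite torsionC torsionDr torsionZr opprD -scalerN.
by rewrite [torsion D Z X]torsionC [torsion D Z Y]torsionC !opprK.
Qed.

End Torsion.

(** * The two forms of a connection and their relation *)

Section FormsOfConnection.
Context {R : realType} {n : nat} {M : manifold R n} (D : connection M).
Context {p : nat} {w : ('I_p -> vfield M) -> Cinf M} (w_form : is_form w).

Lemma cov_deriv_form X : is_form (cov_deriv D X w).
Proof.
exact: (derivation_form (actD X) (act_leibniz X) (nablaD D X)
  (fun f => nabla_leibniz D f X)).
Qed.

Lemma cov_deriv_lin f X Y Z :
  cov_deriv D (f *: X + Y) w Z = f * cov_deriv D X w Z + cov_deriv D Y w Z.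
Proof.
rewrite /cov_deriv; under eq_bigr do rewrite nabla_linl form_lin //.
rewrite big_split /= -mulr_sumr.
rewrite (_ : act (f *: X + Y) (w Z) = f * act X (w Z) + act Y (w Z)).
  by ring.
exact: cfun_inj.
Qed.

Lemma Xi_form_form : is_form (Xi_form D w).
Proof. exact: alternating_sum_form cov_deriv_form cov_deriv_lin. Qed.

(** The [0 -] gives the summand the shape of [derivation_form] with zero symbol. By skew symmetry
    the difference in [form_lift_pairs] is twice the torsion. *)
Lemma torsion_form_double (X : 'I_p.+1 -> vfield M) :
  torsion_form D w X + torsion_form D w X =
  \sum_(i < p.+1) (-1) ^+ i.+1 *
    (0 - \sum_(k < p) w (replace (omit X i) k (torsion D (X i) (omit X i k)))).
Proof.
under eq_bigr do rewrite sub0r mulrN.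
rewrite sumrN (form_lift_pairs w_form (torsion D)) -big_split -sumrN.
apply: eq_bigr => i _ /=; rewrite -big_split -sumrN; apply: eq_bigr => j ij /=.
have ij' : i != j by rewrite -val_eqE neq_ltn ij.
rewrite [torsion D (X j) (X i)]torsionC; move: (torsion D (X i) (X j)) => T.
(* [- T] becomes [T - T - T], so that [form_omit2B] alone leaves only [T] in front. *)
rewrite -[- T]sub0r -(subrr T) !form_omit2B // exprD expr1; ring.
Qed.

Lemma torsion_form_form : is_form (torsion_form D w).
Proof.
apply: form_of_double.
rewrite (funext torsion_form_double).
apply: (@alternating_sum_form _ _ _ _ (fun X Y =>
  0 - \sum_(k < p) w (replace Y k (torsion D X (Y k))))) => [X|f X Y Z].
  apply: (@derivation_form _ _ _ (fun=> 0)) => // [f g|f g|Y Z|f Y].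
  - by rewrite addr0.
  - by rewrite mul0r mulr0 addr0.
  - exact: torsionDr.
  - by rewrite scale0r add0r torsionZr.
under eq_bigr do rewrite torsion_linl form_lin //.
by rewrite big_split /= -mulr_sumr; ring.
Qed.

Lemma torsion_formE : torsion_form D w = ext_d w \+ Xi_form D w.
Proof.
apply/funext => X /=; rewrite /torsion_form /ext_d /Xi_form /cov_deriv.
under [X in _ = _ + X]eq_bigr do rewrite mulrBr.
rewrite sumrB (form_lift_pairs w_form D).
(* The exponent [i.+1 + 1] makes the derivative terms of [ext_d] opposite to those of [Xi_form]. *)
under [X in _ = X + _ + _]eq_bigr do rewrite exprD expr1 mulrN1 mulNr.
rewrite sumrN addrACA addNr add0r -sumrB; apply: eq_bigr => i _.
rewrite -sumrB; apply: eq_bigr => j ij.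
have ij' : i != j by rewrite -val_eqE neq_ltn ij.
(* The bracket in the torsion matches the bracket term of [ext_d], the rest the pair term of
   [Xi_form]. *)
rewrite /torsion [in LHS]form_omit2B // exprD expr1 mulrN1 mulNr -mulrN opprB.
by rewrite mulrBr.
Qed.

End FormsOfConnection.

Theorem theorem2p4 (R : realType) (n : nat) (M : manifold R n)
    (M_connected : connected [set: M]%classic) (D : connection M) (p : nat)
    (Theta : ('I_p -> vfield M) -> Cinf M) (Theta_form : is_form Theta) :
  is_form (torsion_form D Theta) /\ is_form (Xi_form D Theta) /\
  torsion_form D Theta = ext_d Theta \+ Xi_form D Theta.
Proof.
split; first exact: torsion_form_form.
by split; [exact: Xi_form_form | exact: torsion_formE].
Qed.
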